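(* Let $n\geq 1$ and $1\leq k\leq n$ be integers. Then $$\sum_{i=1}^k \genfrac\{\}{0pt}{}{n}{i} = \sum_{\alpha\in\mathcal{P}_k} h(\beta)\,\beta_1^n,$$ $$B_n = \sum_{\alpha\in\mathcal{P}_n} h(\beta)\,\beta_1^n,$$ $$\genfrac\{\}{0pt}{}{n}{k} + \genfrac\{\}{0pt}{}{n}{k-1} = \sum_{\alpha\in\mathcal{P}_k} (-1)^{\theta(\beta)}\, h(\beta)\,\beta_1^n,$$ $$\binom{n}{2}+1 = \sum_{\alpha\in\mathcal{P}_n} (-1)^{\theta(\beta)}\, h(\beta)\,\beta_1^n .$$
   Context: $\genfrac\{\}{0pt}{}{n}{k}$ denotes the Stirling number of the second kind (the number of partitions of an $n$-element set into $k$ nonempty blocks) and $B_n$ the $n$-th Bell number. $\mathcal{P}_k$ is the set of all (unordered) partitions of the integer $k$. For a partition $\alpha$ with parts $\alpha_j$, put $a=\max_j\alpha_j$ and $\beta=\beta(\alpha)=(\beta_1,\dots,\beta_a)$ with $\beta_i=\#\{j:\alpha_j=i\}$; in particular $\beta_1$ is the number of parts of $\alpha$ equal to $1$. Further, $$h(\beta) = \left(\prod_{i=1}^a i^{\beta_i}\,\beta_i!\right)^{-1},\qquad \theta(\beta)=\sum_{i=1}^a(1+i)\beta_i .$$ *)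

(* Defs.v *)
From HB Require Import structures.
From mathcomp Require Import all_boot all_order all_algebra.

Set Implicit Arguments.
Unset Strict Implicit.
Unset Printing Implicit Defensive.

Import GRing.Theory.

Definition stirling2 (n k : nat) : nat :=
  #|[set P : {set {set 'I_n}} | partition P [set: 'I_n] & #|P| == k]|.

Definition bell (n : nat) : nat :=
  #|[set P : {set {set 'I_n}} | partition P [set: 'I_n]]|.

(* A partition of the integer k is unordered; each one is represented by the
   unique list of its parts in weakly decreasing order. *)
Definition is_intpart (k : nat) (s : seq nat) : bool :=
  [&& sorted geq s, all (leq 1) s & sumn s == k].

Record intpart (k : nat) : predArgType :=
  IntPart {parts :> seq nat; _ : is_intpart k parts}.

HB.instance Definition _ k := [isSub for @parts k].
HB.instance Definition _ k := [Countable of intpart k by <:].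

(* Finiteness: a partition of k has at most k parts, each at most k, so it is
   determined by its list of parts padded with zeros to length k. *)
Section IntpartFinite.

Variable k : nat.

Definition intpart_code (p : intpart k) : {ffun 'I_k -> 'I_k.+1} :=
  [ffun i : 'I_k => inord (nth 0 (parts p) i)].

Definition intpart_decode (f : {ffun 'I_k -> 'I_k.+1}) : option (intpart k) :=
  insub [seq x <- [seq val (f i) | i <- enum 'I_k] | 0 < x].

Lemma intpart_codeK : pcancel intpart_code intpart_decode.
Proof.
case=> s sP; rewrite /intpart_decode.
suff -> : [seq x <- [seq val (intpart_code (IntPart sP) i) | i <- enum 'I_k]
          | 0 < x] = s by rewrite (insubT (is_intpart k) sP).
have /and3P[_ pos_s /eqP sum_s] := sP.
have size_s : size s <= k.
  rewrite -sum_s; elim: s pos_s {sP sum_s} => //= x s IHs /andP[x0 /IHs le_s].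
  by rewrite -add1n leq_add.
have nth_s i : nth 0 s i <= k.
  rewrite -sum_s; elim: s i {sP pos_s sum_s size_s} => [|x s IHs] [|i] //=.
    exact: leq_addr.
  exact: leq_trans (IHs i) (leq_addl _ _).
have -> : [seq val (intpart_code (IntPart sP) i) | i <- enum 'I_k]
          = mkseq (nth 0 s) k.
  rewrite /mkseq -val_enum_ord -map_comp; apply: eq_map => i /=.
  by rewrite ffunE inordK // ltnS.
have -> : mkseq (nth 0 s) k = s ++ nseq (k - size s) 0.
  apply: (@eq_from_nth _ 0).
    by rewrite size_mkseq size_cat size_nseq subnKC.
  move=> i; rewrite size_mkseq => lt_ik; rewrite nth_mkseq // nth_cat.
  case: ltnP => // le_si.
  by rewrite nth_nseq if_same nth_default.
rewrite filter_cat (all_filterP pos_s).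
by rewrite (_ : filter _ (nseq _ 0) = [::]) ?cats0 //; elim: (_ - _).
Qed.

HB.instance Definition _ : isFinite (intpart k) := PCanIsFinite intpart_codeK.

End IntpartFinite.

Definition maxpart (k : nat) (alpha : intpart k) : nat :=
  \max_(j <- parts alpha) j.

Definition beta (k : nat) (alpha : intpart k) : seq nat :=
  [seq count_mem i (parts alpha) | i <- iota 1 (maxpart alpha)].

(* Entries of beta are numbered from 1. *)
Definition entry (b : seq nat) (i : nat) : nat := nth 0 b i.-1.

Definition h (b : seq nat) : rat :=
  ((\prod_(1 <= i < (size b).+1) (i ^ entry b i * (entry b i)`!))%N%:R^-1)%R.

Definition theta (b : seq nat) : nat :=
  \sum_(1 <= i < (size b).+1) (1 + i) * entry b i.

(* Main.v *)
Require Import Defs.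
From mathcomp Require Import all_boot all_order all_algebra.

Set Implicit Arguments.
Unset Strict Implicit.
Unset Printing Implicit Defensive.

Import GRing.Theory Num.Theory.

(** The number [h (beta a)] is the proportion of permutations of [k] points
    whose cycle type is [a]; [(-1) ^ theta] is the sign of such a permutation
    and [beta_1] its number of fixed points.  The right-hand sides are therefore
    the plain and the signed average of [fix ^ n] over the symmetric group.
    These averages are computed here on partitions alone.

    A function from [n] points to [x] points is an injection of the blocks of
    its kernel, so [x ^ n] is the sum over [i] of [stirling2 n i * x ^_ i]
    ([expn_stirling2]).  It remains to find the factorial moments of [beta_1].
    The key is [sum_remove_part]: deleting one part [i] from a partition [a]
    multiplies [h] by [i * beta_i].  Deleting [i] parts equal to [1] turns the
    [i]-th factorial moment over the partitions of [k] into the total weight of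
    the partitions of [k - i] ([ffact_moment]).

    The total weight of the partitions of [m] comes from the same lemma: since
    [m] is the sum of all [i * beta_i], deleting a part of every possible size
    gives a recursion on [m] ([weight_sum_rec]).  It is [1] for the plain
    weight; for the signed weight it is [1] when [m <= 1] and [0] otherwise,
    as even and odd permutations balance.  So the plain moment keeps every
    [stirling2 n i] with [i <= k], which for [k = n] add up to the Bell number,
    and the signed one keeps only [i = k] and [i = k - 1].

    For the last identity no Stirling number has to be evaluated: expanding
    [beta_1 ^ n.+1 = beta_1 * (1 + (beta_1 - 1)) ^ n] and deleting a part [1]
    expresses a moment by those of lower order ([moment_rec]), and nearly all of
    the signed ones vanish ([moment_signed_diag]). *)

(** * Multiplicities of the parts of an integer partition *)

Lemma intpartP k (a : intpart k) : is_intpart k a.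
Proof. exact: (valP a). Qed.

Lemma intpart_sum k (a : intpart k) : sumn a = k.
Proof. by have /and3P[_ _ /eqP] := intpartP a. Qed.

Lemma intpart_gt0 k (a : intpart k) i : i \in parts a -> 0 < i.
Proof. by have /and3P[_ /allP pos_a _] := intpartP a; apply: pos_a. Qed.

Lemma intpart_le k (a : intpart k) i : i \in parts a -> i <= k.
Proof.
move=> ia; rewrite -[k in _ <= k](intpart_sum a) sumnE.
by rewrite (big_rem i ia) leq_addr.
Qed.

Lemma maxpart_le k (a : intpart k) : maxpart a <= k.
Proof. by apply/bigmax_leqP_seq => i ia _; apply: intpart_le ia. Qed.

Lemma maxpart_lt_count k (a : intpart k) i :
  maxpart a < i -> count_mem i (parts a) = 0.
Proof.
move=> lt_max; apply/count_memPn/negP => ia.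
by move: lt_max; rewrite ltnNge (bigmaxn_sup_seq i ia).
Qed.

Lemma entry_beta k (a : intpart k) i :
  0 < i -> entry (beta a) i = count_mem i (parts a).
Proof.
case: i => // i _; rewrite /entry /=.
have [lt_i | le_i] := ltnP i (maxpart a).
  by rewrite (nth_map 0) ?size_iota // nth_iota // add1n.
by rewrite nth_default ?size_map ?size_iota // maxpart_lt_count.
Qed.

(** The entries of [beta a] stop at the largest part; padding the range with
    zero multiplicities up to a common bound makes different partitions
    comparable. *)
Lemma big_beta R (idx : R) (op : Monoid.law idx) (F : nat -> nat -> R)
    k (a : intpart k) N :
  (forall i, F i 0 = idx) -> k <= N ->
  \big[op/idx]_(1 <= i < (size (beta a)).+1) F i (entry (beta a) i)
    = \big[op/idx]_(1 <= i < N.+1) F i (count_mem i (parts a)).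
Proof.
move=> F0 le_kN; rewrite size_map size_iota.
have le_aN : maxpart a <= N by apply: leq_trans le_kN; apply: maxpart_le.
rewrite [RHS](@big_cat_nat _ _ _ (maxpart a).+1) //=.
rewrite [X in op _ X]big_nat_cond [X in op _ X]big1 ?Monoid.mulm1; last first.
  by move=> i /andP[/andP[lt_ai _] _]; rewrite maxpart_lt_count.
by apply: eq_big_nat => i /andP[i_gt0 _]; rewrite entry_beta.
Qed.

Lemma sum_part_count k (a : intpart k) :
  \sum_(1 <= i < k.+1) i * count_mem i (parts a) = k.
Proof.
rewrite -[RHS](intpart_sum a) sumnE.
have: {in parts a, forall j, 0 < j <= k}.
  by move=> j ja; rewrite (intpart_gt0 ja) (intpart_le ja).
elim: (parts a) => [|j s IHs] le_sk.
  by rewrite big_nil big1 // => i _; rewrite muln0.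
rewrite big_cons -{}IHs => [|i si]; last by apply: le_sk; rewrite inE si orbT.
under eq_bigr => i _ do rewrite /= mulnDr.
rewrite big_split /=; congr (_ + _).
have /le_sk lt_j : j \in j :: s by rewrite inE eqxx.
transitivity (\sum_(1 <= i < k.+1 | i == j) i).
  rewrite [RHS]big_mkcond; apply: eq_bigr => i _.
  by rewrite eq_sym; case: eqP; rewrite ?muln1 ?muln0.
by rewrite big_nat1_eq ltnS lt_j.
Qed.

(** * Inserting a part *)

Lemma insert_part_subproof m k i (b : intpart k) :
  0 < i -> i + k = m -> is_intpart m (sort geq (i :: parts b)).
Proof.
move=> i_gt0 <-; apply/and3P; split.
- by apply: sort_sorted => x y; apply: leq_total.
- by rewrite all_sort /= i_gt0; have /and3P[] := intpartP b.
- have /permPl/perm_sumn-> := perm_sort geq (i :: parts b).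
  by rewrite /= intpart_sum.
Qed.

(** The size [m] is tied to [i + k] by an equation, because one sum over the
    partitions of a fixed [m] deletes parts of all sizes [i]. *)
Definition insert_part m k i (i_gt0 : 0 < i) (def_m : i + k = m)
    (b : intpart k) : intpart m :=
  IntPart (insert_part_subproof b i_gt0 def_m).

Section InsertPart.

Variables (m k i : nat) (i_gt0 : 0 < i) (def_m : i + k = m).

Local Notation insert := (insert_part i_gt0 def_m).

Lemma perm_insert_part (b : intpart k) :
  perm_eq (parts (insert b)) (i :: parts b).
Proof. by apply/permPl/perm_sort. Qed.

Lemma count_insert_part (b : intpart k) j :
  count_mem j (parts (insert b)) = (i == j) + count_mem j (parts b).
Proof. exact: (permP (perm_insert_part b) (pred1 j)). Qed.

Lemma intpart_perm_inj l (a b : intpart l) :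
  perm_eq (parts a) (parts b) -> a = b.
Proof.
move=> eq_ab; apply: val_inj; apply: (@sorted_eq _ geq) eq_ab.
- by move=> x y z le_xy le_zx; apply: leq_trans le_zx le_xy.
- by move=> x y; rewrite andbC => /anti_leq.
- by have /and3P[] := intpartP a.
- by have /and3P[] := intpartP b.
Qed.

Lemma insert_part_inj : injective insert.
Proof.
move=> b c eq_bc; apply: intpart_perm_inj.
rewrite -(perm_cons i) -(permPl (perm_insert_part b)) eq_bc.
exact: perm_insert_part.
Qed.

Lemma insert_part_onto (a : intpart m) :
  i \in parts a -> exists b, a = insert b.
Proof.
move=> ia; have perm_a := perm_to_rem ia.
have remP : is_intpart k (rem i (parts a)).
  have /and3P[sorted_a pos_a _] := intpartP a; apply/and3P; split.
  - apply: (subseq_sorted _ (rem_subseq i _) sorted_a).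
    by move=> x y z le_xy le_zx; apply: leq_trans le_zx le_xy.
  - by apply/allP => j /mem_rem ja; apply: (allP pos_a).
  - rewrite -(eqn_add2l i) def_m -[X in _ == X](intpart_sum a).
    by rewrite (perm_sumn perm_a).
exists (IntPart remP); apply: intpart_perm_inj.
by rewrite (permPl perm_a) perm_sym perm_insert_part.
Qed.

End InsertPart.

(** * Kernels of finite functions *)

Section Kernels.

Variable T rT : finType.

Section OneKernel.

Variables (P : {set {set T}}) (partP : partition P [set: T]).

Local Notation block := {B : {set T} | B \in P}.

Lemma pblock_in_partition x : pblock P x \in P.
Proof. by apply: pblock_mem; rewrite (cover_partition partP) inE. Qed.

(** [lift_blocks] turns an injection of the blocks of [P] into a function whose
    kernel is [P], and every such function arises once
    ([lift_blocks_inj], [lift_blocks_kernel]). *)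
Definition lift_blocks (g : {ffun block -> rT}) : {ffun T -> rT} :=
  [ffun x => g (exist _ (pblock P x) (pblock_in_partition x))].

Lemma block_inhabited (B : block) : exists x, x \in val B.
Proof. by apply/set0Pn; apply: partition_neq0 partP (valP B). Qed.

Lemma pblock_block (B : block) x : x \in val B -> pblock P x = val B.
Proof.
by have /and3P[_ trivP _] := partP; apply: def_pblock trivP (valP B).
Qed.

Lemma lift_blocks_inj : injective lift_blocks.
Proof.
move=> g1 g2 /ffunP eq_g; apply/ffunP => B.
have [x Bx] := block_inhabited B; have := eq_g x; rewrite !ffunE.
by have -> : exist _ (pblock P x) (pblock_in_partition x) = B
  by apply: val_inj; apply: pblock_block.
Qed.

Lemma lift_blocks_kernel :
  lift_blocks @: [set g : {ffun block -> rT} | injectiveb g]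
    = [set f : {ffun T -> rT} | preim_partition f [set: T] == P].
Proof.
apply/setP => f; rewrite inE; apply/imsetP/eqP => [[g]|kerf].
  rewrite inE => /injectiveP inj_g ->.
  rewrite -[RHS](preim_partition_pblock partP); apply: eq_imset => x.
  apply/setP => y; rewrite !inE !ffunE (inj_eq inj_g).
  by rewrite -val_eqE.
have eq_f x y : (f x == f y) = (pblock P x == pblock P y).
  have /and3P[/eqP covP trivP _] := partP.
  rewrite eq_pblock ?covP ?inE // -kerf pblock_equivalence_partition ?inE //.
  by move=> u v w _ _ _; split=> // /eqP->.
(* [f] is constant on blocks, so [g] can use any representative. *)
pose g := [ffun B : block => f (xchoose (block_inhabited B))].
exists g; last first.
  apply/ffunP => x; rewrite !ffunE; apply/eqP; rewrite eq_f.
  by rewrite (pblock_block (xchooseP (block_inhabited _))).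
rewrite inE; apply/injectiveP => B C /eqP; rewrite !ffunE eq_f.
by rewrite !(pblock_block (xchooseP (block_inhabited _))) => /eqP/val_inj.
Qed.

Lemma card_kernel :
  #|[set f : {ffun T -> rT} | preim_partition f [set: T] == P]|
    = #|rT| ^_ #|P|.
Proof.
rewrite -lift_blocks_kernel card_imset; last exact: lift_blocks_inj.
by rewrite card_inj_ffuns card_sig.
Qed.

End OneKernel.

(** Sort all functions from [T] to [rT] by their kernel. *)
Lemma expn_sum_partition :
  #|rT| ^ #|T| = \sum_(P : {set {set T}} | partition P [set: T]) #|rT| ^_ #|P|.
Proof.
rewrite -card_ffun -sum1_card.
rewrite (partition_big (fun f : {ffun T -> rT} => preim_partition f [set: T])
  (fun P => partition P [set: T])) => [|f _]; last exact: preim_partitionP.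
apply: eq_bigr => P partP; rewrite -(card_kernel partP) -sum1_card.
by apply: eq_bigl => f; rewrite inE.
Qed.

End Kernels.

Lemma card_partition_le (T : finType) (P : {set {set T}}) (D : {set T}) :
  partition P D -> #|P| <= #|D|.
Proof.
move=> partP; rewrite (card_partition partP) -sum1_card; apply: leq_sum => B PB.
by rewrite card_gt0 (partition_neq0 partP).
Qed.

Lemma sum_partition_stirling2 n (F : nat -> nat) :
  \sum_(P : {set {set 'I_n}} | partition P [set: 'I_n]) F #|P|
    = \sum_(i < n.+1) stirling2 n i * F i.
Proof.
have cardK (P : {set {set 'I_n}}) :
    partition P [set: 'I_n] -> (inord #|P| : 'I_n.+1) = #|P| :> nat.
  move=> partP; rewrite inordK // ltnS.
  by have := card_partition_le partP; rewrite cardsT card_ord.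
rewrite (partition_big
  (fun P : {set {set 'I_n}} => inord #|P| : 'I_n.+1) xpredT) //.
apply: eq_bigr => i _; rewrite -sum_nat_const.
apply: eq_big => [P | P /andP[partP /eqP <-]]; rewrite ?inE.
  by apply: andb_id2l => partP; rewrite -val_eqE /= cardK.
by rewrite cardK.
Qed.

Lemma expn_stirling2 x n : x ^ n = \sum_(i < n.+1) stirling2 n i * x ^_ i.
Proof.
have := expn_sum_partition 'I_n 'I_x.
by rewrite !card_ord (sum_partition_stirling2 n (fun i => x ^_ i)).
Qed.

Lemma bell_stirling2 n : bell n = \sum_(i < n.+1) stirling2 n i.
Proof.
have := sum_partition_stirling2 n (fun=> 1).
rewrite sum1dep_card -/(bell n) => ->.
by apply: eq_bigr => i _; rewrite muln1.
Qed.

Lemma stirling2n0 n : 0 < n -> stirling2 n 0 = 0.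
Proof.
move=> n_gt0; apply/eqP; rewrite cards_eq0; apply/eqP/setP => P.
rewrite !inE; apply/negP => /andP[partP /eqP/cards0_eq P0].
have := card_partition partP; rewrite P0 big_set0 cardsT card_ord => n0.
by rewrite n0 in n_gt0.
Qed.

(** * Deletion of a part in weighted sums over integer partitions *)

Local Open Scope ring_scope.

(** Keeping the base [t] free treats the plain case [t = 1] and the signed case
    [t = -1] together. *)
Definition weight (t : rat) k (a : intpart k) : rat :=
  t ^+ theta (beta a) * h (beta a).

Section Weights.

Variable t : rat.

Lemma weight_count k (a : intpart k) N : (k <= N)%N ->
  weight t a = t ^+ (\sum_(1 <= i < N.+1) (1 + i) * count_mem i (parts a))%N
    * ((\prod_(1 <= i < N.+1)
          (i ^ count_mem i (parts a) * (count_mem i (parts a))`!))%N%:R)^-1.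
Proof.
move=> le_kN; rewrite /weight /theta /h.
rewrite (@big_beta _ _ _ (fun i c => ((1 + i) * c)%N) _ _ N) // => [|i].
  2: exact: muln0.
by rewrite (@big_beta _ _ _ (fun i c => (i ^ c * c`!)%N) _ _ N).
Qed.

(** In the denominator of [h], one more part [i] brings a factor [i] from
    [i ^ beta_i] and a factor [beta_i] from the factorial; in [theta] it brings
    [1 + i]. *)
Lemma weight_insert_part m k i (i_gt0 : (0 < i)%N) (def_m : (i + k = m)%N)
    (b : intpart k) :
  weight t (insert_part i_gt0 def_m b)
    * (i * count_mem i (parts (insert_part i_gt0 def_m b)))%:R
    = t ^+ i.+1 * weight t b.
Proof.
have le_km : (k <= m)%N by rewrite -def_m leq_addl.
have i_in : (1 <= i < m.+1)%N by rewrite i_gt0 ltnS -def_m leq_addr.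
rewrite (weight_count _ (leqnn m)) (weight_count b le_km).
set c := fun j => count_mem j (parts b).
have cE j :
    count_mem j (parts (insert_part i_gt0 def_m b)) = ((j == i) + c j)%N.
  by rewrite count_insert_part eq_sym.
under eq_bigr => j _ do rewrite cE mulnDr.
rewrite big_split /=.
have -> : (\sum_(1 <= j < m.+1) (1 + j) * (j == i) = i.+1)%N.
  transitivity (\sum_(1 <= j < m.+1 | j == i) (1 + j))%N.
    rewrite [RHS]big_mkcond; apply: eq_bigr => j _.
    by case: eqP; rewrite ?muln1 ?muln0.
  by rewrite big_nat1_eq i_in.
under [X in X%:R^-1]eq_bigr => j _ do rewrite cE.
have -> : (\prod_(1 <= j < m.+1) (j ^ ((j == i) + c j) * ((j == i) + c j)`!)
    = i * (c i).+1 * \prod_(1 <= j < m.+1) (j ^ c j * (c j)`!))%N.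
  transitivity (\prod_(1 <= j < m.+1) ((if j == i then j * (c j).+1 else 1)
     * (j ^ c j * (c j)`!)))%N.
    apply: eq_bigr => j _; case: eqP => _; last by rewrite mul1n.
    by rewrite add1n expnS factS mulnACA.
  by rewrite big_split /= -big_mkcond big_nat1_eq i_in.
rewrite cE eqxx add1n natrM invfM exprD -!mulrA; congr (_ * (_ * _)).
rewrite mulrCA mulVf ?mulr1 //.
by rewrite pnatr_eq0 -lt0n muln_gt0 i_gt0.
Qed.

(** The factor [beta_i] kills the partitions without a part [i]; all others
    arise from exactly one partition of [k] by inserting [i]. *)
Lemma sum_remove_part m k i (i_gt0 : (0 < i)%N) (def_m : (i + k = m)%N)
    (G : intpart m -> rat) :
  \sum_(a : intpart m) weight t a * (i * count_mem i (parts a))%:R * G a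
    = t ^+ i.+1
        * \sum_(b : intpart k) weight t b * G (insert_part i_gt0 def_m b).
Proof.
rewrite (bigID (fun a : intpart m => i \in parts a)) /=.
rewrite [X in _ + X]big1 ?addr0; last first.
  by move=> a /count_memPn->; rewrite muln0 mulr0 mul0r.
transitivity
    (\sum_(a in [set insert_part i_gt0 def_m b | b in [set: intpart k]])
       weight t a * (i * count_mem i (parts a))%:R * G a).
  apply: eq_bigl => a; apply/idP/imsetP => [ia | [b _ ->]].
    by have [b ->] := insert_part_onto i_gt0 def_m ia; exists b.
  by rewrite (perm_mem (perm_insert_part _ _ _)) mem_head.
rewrite big_imset; last by move=> b c _ _; apply: insert_part_inj.
rewrite mulr_sumr; apply: eq_big => [b | b _]; first by rewrite inE.
by rewrite weight_insert_part mulrA.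
Qed.

Definition weight_sum m : rat := \sum_(a : intpart m) weight t a.

Lemma weight_sum0 : weight_sum 0 = 1.
Proof.
have P0 : is_intpart 0 [::] by [].
have all0 (a : intpart 0) : a = IntPart P0.
  apply: intpart_perm_inj; rewrite /=; case E : (parts a) => [|j s] //.
  have ja : j \in parts a by rewrite E mem_head.
  by have := intpart_gt0 ja; rewrite ltnNge (intpart_le ja).
rewrite /weight_sum (bigD1 (IntPart P0)) //= big1 ?addr0; last first.
  by move=> a; rewrite (all0 a) eqxx.
by rewrite (weight_count _ (leqnn 0)) !big_geq // mul1r invr1.
Qed.

(** Expand [m] as the sum of all [i * beta_i] and delete one part of each size;
    the index below is the size [m - i] of what is left. *)
Lemma weight_sum_rec m :
  m%:R * weight_sum m = \sum_(i < m) t ^+ (m - i).+1 * weight_sum i.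
Proof.
transitivity (\sum_(1 <= i < m.+1) \sum_(a : intpart m)
    weight t a * (i * count_mem i (parts a))%:R * 1).
  rewrite exchange_big mulrC mulr_suml; apply: eq_bigr => a _.
  rewrite -[X in _ * X%:R](sum_part_count a) natr_sum mulr_sumr.
  by apply: eq_bigr => i _; rewrite mulr1.
rewrite big_add1 /= big_nat_rev big_mkord /=; apply: eq_bigr => i _.
have def_m : ((m - i.+1).+1 + i = m)%N by rewrite subnSK ?subnK // ltnW.
rewrite add0n (sum_remove_part (ltn0Sn _) def_m (fun=> 1)).
rewrite subnSK //; congr (_ * _).
by apply: eq_bigr => b _; rewrite mulr1.
Qed.

Lemma sum_remove_one k (F : nat -> rat) :
  \sum_(a : intpart k.+1) weight t a * (count_mem 1%N (parts a))%:R
      * F (count_mem 1%N (parts a)).-1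
    = t ^+ 2 * \sum_(b : intpart k) weight t b * F (count_mem 1%N (parts b)).
Proof.
have := sum_remove_part (ltn0Sn 0) (add1n k)
  (fun a => F (count_mem 1%N (parts a)).-1).
under eq_bigr => a _ do rewrite mul1n.
move=> ->; congr (_ * _); apply: eq_bigr => b _.
by rewrite count_insert_part.
Qed.

Lemma count1_le k (a : intpart k) : (count_mem 1%N (parts a) <= k)%N.
Proof.
case: k a => [|k] a; last first.
  by rewrite -[X in (_ <= X)%N](sum_part_count a) big_ltn // mul1n leq_addr.
rewrite leqn0; apply/eqP/count_memPn/negP => ja.
by have := intpart_le ja.
Qed.

Hypothesis t2 : t ^+ 2 = 1.

(** [beta_1 ^_ i.+1 = beta_1 * (beta_1 - 1) ^_ i], so each step deletes one part
    equal to [1]; the sign is unchanged because that part adds [2] to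
    [theta]. *)
Lemma ffact_moment k i :
  \sum_(a : intpart k) weight t a * (count_mem 1%N (parts a) ^_ i)%:R
    = if (i <= k)%N then weight_sum (k - i) else 0.
Proof.
elim: i k => [|i IHi] k.
  by rewrite subn0; apply: eq_bigr => a _; rewrite ffactn0 mulr1.
case: k => [|k].
  rewrite big1 // => a _; have := count1_le a; rewrite leqn0 => /eqP->.
  by rewrite ffact0n mulr0.
under eq_bigr => a _ do rewrite ffactnS natrM mulrA.
rewrite (sum_remove_one k (fun c => (c ^_ i)%:R)) t2 mul1r IHi.
by rewrite ltnS subSS.
Qed.

Definition moment k n : rat :=
  \sum_(a : intpart k) weight t a * (count_mem 1%N (parts a))%:R ^+ n.

Lemma moment_stirling2 k n :
  moment k n
    = \sum_(i < n.+1) (stirling2 n i)%:R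
        * (if (i <= k)%N then weight_sum (k - i) else 0).
Proof.
under [RHS]eq_bigr => i _ do rewrite -ffact_moment big_distrr /=.
rewrite exchange_big; apply: eq_bigr => a _.
rewrite -natrX expn_stirling2 natr_sum big_distrr /=.
by apply: eq_bigr => i _; rewrite natrM mulrCA.
Qed.

Lemma moment_rec k n :
  moment k.+1 n.+1 = \sum_(j < n.+1) moment k j *+ 'C(n, j).
Proof.
transitivity (\sum_(a : intpart k.+1)
    weight t a * (count_mem 1%N (parts a))%:R
      * (1 + (count_mem 1%N (parts a)).-1%:R) ^+ n).
  apply: eq_bigr => a _; rewrite -mulrA; congr (_ * _).
  (* The leading factor [beta_1] hides the truncated predecessor of [0]. *)
  case: (count_mem _ _) => [|c]; first by rewrite mul0r expr0n.
  by rewrite /= -natr1 [1 + _]addrC exprS.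
rewrite (sum_remove_one k (fun c => (1 + c%:R) ^+ n)) t2 mul1r.
under eq_bigr => a _ do rewrite exprDn big_distrr /=.
rewrite exchange_big; apply: eq_bigr => j _; rewrite -sumrMnl.
by apply: eq_bigr => a _; rewrite expr1n mul1r mulrnAr.
Qed.

End Weights.

(** * The plain and the signed moments *)

Lemma weight_sum_plain m : weight_sum 1 m = 1.
Proof.
elim/ltn_ind: m => -[|m] IHm; first exact: weight_sum0.
apply: (@mulfI _ m.+1%:R); first by rewrite pnatr_eq0.
rewrite weight_sum_rec mulr1 -[in RHS](card_ord m.+1) -sum1_card natr_sum.
by apply: eq_bigr => i _; rewrite IHm // expr1n mulr1.
Qed.

Lemma weight_sum_signed m : weight_sum (-1) m = (m <= 1)%N%:R.
Proof.
elim/ltn_ind: m => -[|m] IHm; first exact: weight_sum0.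
apply: (@mulfI _ m.+1%:R); first by rewrite pnatr_eq0.
rewrite weight_sum_rec.
under eq_bigr => i _ do rewrite IHm //.
case: m {IHm} => [|m]; first by rewrite big_ord1 /= subn0 sqrrN !mulr1 expr1n.
(* Only the weight sums at [0] and [1] survive, with opposite signs. *)
rewrite 2!big_ord_recl big1 => [|i _]; last by rewrite mulr0.
rewrite /= !mulr1 mulr0 addr0 subn0 /bump subn1 /=.
by rewrite [_ ^+ m.+3]exprS mulN1r addNr.
Qed.

(** In [moment_rec] a signed moment of order [n] is a combination of those of
    order [j <= n - 1] over the partitions of [k - 1].  They vanish for
    [j < k - 2] and equal [1] for [j = k - 2], so on the diagonal [n = k] each
    step from [n = 2] on adds ['C(n - 1, n - 2) = n - 1]. *)
Lemma moment_signed_diag k n : (n <= k)%N ->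
  moment (-1) k n = if n == k then ('C(n, 2) + 1)%N%:R else (n.+1 == k)%:R.
Proof.
have sq1 : (-1) ^+ 2 = 1 :> rat by rewrite sqrrN expr1n.
elim: k n => [|k IHk] [|n] // le_nk; last first.
  rewrite ltnS in le_nk; rewrite moment_rec // !eqSS.
  rewrite big_ord_recr /= binn mulr1n IHk //.
  case: n le_nk => [|n] le_nk.
    by rewrite big_ord0 add0r; case: eqP => // <-.
  have lt_k (i : 'I_n) : moment (-1) k i = 0.
    have lt_ik : (i.+1 < k)%N by apply: leq_trans le_nk; rewrite ltnS.
    rewrite IHk; last by apply: ltnW; apply: ltnW.
    by rewrite (ltn_eqF (ltnW lt_ik)) (ltn_eqF lt_ik).
  rewrite big_ord_recr /= big1 => [|i _]; last by rewrite lt_k mul0rn.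
  rewrite add0r IHk; last exact: ltnW.
  rewrite (ltn_eqF le_nk); case: eqP => [_|_]; last by rewrite mul0rn add0r.
  rewrite binSn (binS n.+1) bin1 -[_ *+ _]/(n.+1%:R) -natrD.
  by rewrite addnA [(n.+1 + _)%N]addnC.
all: have -> l : moment (-1) l 0 = weight_sum (-1) l
  by apply: eq_bigr => a _; rewrite expr0 mulr1.
all: rewrite weight_sum_signed //.
by rewrite eqSS; case: k {IHk le_nk}.
Qed.

Lemma weight_entry t n k :
  \sum_(a : intpart k) t ^+ theta (beta a) * h (beta a)
      * (entry (beta a) 1)%:R ^+ n = moment t k n.
Proof. by apply: eq_bigr => a _; rewrite entry_beta. Qed.

Lemma moment_plain n k : (0 < n)%N -> (k <= n)%N ->
  moment 1 k n = (\sum_(1 <= i < k.+1) stirling2 n i)%N%:R.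
Proof.
move=> n_gt0 le_kn; rewrite moment_stirling2 ?expr1n // -(big_mkord xpredT
  (fun i => (stirling2 n i)%:R
     * (if (i <= k)%N then weight_sum 1 (k - i) else 0))).
rewrite big_ltn // stirling2n0 // mul0r add0r.
rewrite (@big_cat_nat _ _ _ k.+1) //= [X in _ + X]big_nat_cond.
rewrite [X in _ + X]big1 ?addr0; last first.
  by move=> i /andP[/andP[lt_ki _] _]; rewrite leqNgt lt_ki mulr0.
rewrite natr_sum; apply: eq_big_nat => i /andP[_ lt_ik].
by rewrite -ltnS lt_ik weight_sum_plain mulr1.
Qed.

Lemma moment_signed n k : (0 < k)%N -> (k <= n)%N ->
  moment (-1) k n = (stirling2 n k + stirling2 n (k - 1))%N%:R.
Proof.
case: k => // k _ lt_kn; rewrite moment_stirling2 ?sqrrN ?expr1n // subn1 /=.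
have lt_k : (k < n.+1)%N by apply: ltnW.
have lt_Sk : (k.+1 < n.+1)%N by [].
rewrite (bigD1 (Ordinal lt_k)) // (bigD1 (Ordinal lt_Sk)) /=; last first.
  by rewrite -val_eqE /= gtn_eqF.
rewrite leqnSn leqnn subSnn subnn !weight_sum_signed.
rewrite big1 ?addr0 => [|i]; last first.
  rewrite -!val_eqE /= => /andP[ne_ik ne_iSk]; rewrite weight_sum_signed.
  case: leqP => [le_iSk|_]; last by rewrite mulr0.
  have lt_ik : (i < k)%N by rewrite ltn_neqAle ne_ik -ltnS ltn_neqAle ne_iSk.
  by rewrite leq_subLR addn1 ltnS leqNgt lt_ik mulr0.
by rewrite !mulr1 addrC natrD.
Qed.

Theorem corollary6 (n k : nat) (hn : (1 <= n)%N) (hk1 : (1 <= k)%N)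
    (hkn : (k <= n)%N) :
  [/\ (\sum_(1 <= i < k.+1) stirling2 n i)%N%:R
        = \sum_(alpha : intpart k)
            h (beta alpha) * (entry (beta alpha) 1)%:R ^+ n :> rat,
      (bell n)%:R
        = \sum_(alpha : intpart n)
            h (beta alpha) * (entry (beta alpha) 1)%:R ^+ n :> rat,
      (stirling2 n k + stirling2 n (k - 1))%N%:R
        = \sum_(alpha : intpart k)
            (-1) ^+ theta (beta alpha) * h (beta alpha)
              * (entry (beta alpha) 1)%:R ^+ n :> rat
    & ('C(n, 2) + 1)%N%:R
        = \sum_(alpha : intpart n)
            (-1) ^+ theta (beta alpha) * h (beta alpha)
              * (entry (beta alpha) 1)%:R ^+ n :> rat].
Proof.
have plain l : \sum_(alpha : intpart l)
    h (beta alpha) * (entry (beta alpha) 1)%:R ^+ n = moment 1 l n.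
  by rewrite -weight_entry; apply: eq_bigr => a _; rewrite expr1n mul1r.
split; rewrite ?plain ?weight_entry.
- by rewrite moment_plain.
- rewrite moment_plain // bell_stirling2.
  by rewrite -(big_mkord xpredT (stirling2 n)) big_ltn // stirling2n0.
- by rewrite moment_signed.
- by rewrite moment_signed_diag // eqxx.
Qed.
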